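(* There does not exist a function $N(d,r)$ of pairs of positive integers $d, r$, with values in $\mathbb{N}$, such that for all $d$ and $r$, all $n \in \mathbb{N}$, and every $\mathrm{GL}$-ideal $I \subset \mathbf{A}_n$ equivariantly generated by $r$ homogeneous polynomials of degree $\le d$, the regularity of $I$ is less than $N(d,r)$.
   Context: Here $\mathbb{N}=\{1,2,3,\dots\}$. For $n \in \mathbb{N}$ let $\mathbf{A}_n = \mathrm{Sym}(\mathbb{C}^n \otimes \mathbb{C}^\infty)$, identified with the polynomial ring $\mathbb{C}[x_{i,j} \mid 1 \le i \le n,\ j \in \mathbb{N}]$ (with $x_{i,j}$ corresponding to $e_i \otimes e_j$), graded by $\deg x_{i,j} = 1$. The group $\mathrm{GL}_\infty = \bigcup_{k\ge 1} \mathrm{GL}_k(\mathbb{C})$ acts on $\mathbf{A}_n$ by $\mathbb{C}$-algebra automorphisms through its natural action on the factor $\mathbb{C}^\infty$, i.e. $h\cdot x_{i,j} = \sum_k h_{k,j} x_{i,k}$. A $\mathrm{GL}$-ideal of $\mathbf{A}_n$ is an ideal stable under $\mathrm{GL}_\infty$; it is equivariantly generated by $f_1,\dots,f_r \in \mathbf{A}_n$ if it is the smallest $\mathrm{GL}$-ideal containing $f_1,\dots,f_r$. The regularity of a homogeneous ideal $I\subset \mathbf{A}_n$ is the Castelnuovo--Mumford regularity of $I$ as a graded $\mathbf{A}_n$-module, $\sup\{\, j - i \mid \mathrm{Tor}_i^{\mathbf{A}_n}(I,\mathbb{C})_j \neq 0 \,\}$, where $\mathbb{C}$ is the quotient of $\mathbf{A}_n$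 by the ideal generated by all the variables. *)

(* Defs.v *)
From HB Require Import structures.
From mathcomp Require Import all_boot all_order all_algebra.
From mathcomp Require Import finmap monalg complex.
From mathcomp Require Import boolp classical_sets functions reals ereal.

Set Implicit Arguments.
Unset Strict Implicit.
Unset Printing Implicit Defensive.

Import Order.TTheory GRing.Theory Num.Theory.
Local Open Scope classical_set_scope.
Local Open Scope ring_scope.

(* The complex numbers are [R[i]] for a model [R] of the real numbers.  The
   variable x_(i, j) has row index [i : 'I_n] and column index [j : nat]
   (both counted from 0). *)
Notation polyA R n := {malg (R[i])[{cmonom ('I_n * nat)%type}]}.

Definition varA (R : realType) (n : nat) (v : 'I_n * nat) : polyA R n :=
  << ucm v >>.

(* 0 is homogeneous of every degree. *)
Definition homogA (R : realType) (n : nat) (j : int) (p : polyA R n) : Prop :=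
  forall m, m \in msupp p -> (mdeg m)%:Z = j.

(* An element of GL_oo is represented by an invertible k x k matrix, for some k,
   which acts as the identity on the columns of index at least k. *)
Definition gl_var (R : realType) (n k : nat) (g : 'M[R[i]]_k)
    (v : 'I_n * nat) : polyA R n :=
  if insub v.2 is Some j then \sum_(l < k) malgC (g l j) * varA R (v.1, val l)
  else varA R v.

Definition gl_act (R : realType) (n k : nat) (g : 'M[R[i]]_k)
    (p : polyA R n) : polyA R n :=
  mmap malgC
    (fun m : {cmonom ('I_n * nat)%type} =>
       \prod_(v <- finsupp m) gl_var g v ^+ m v) p.

Definition ideal (R : realType) (n : nat) (I : set (polyA R n)) : Prop :=
  I 0 /\ forall a p q, I p -> I q -> I (a * p + q).

Definition GL_ideal (R : realType) (n : nat) (I : set (polyA R n)) : Prop :=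
  ideal I /\
  forall (k : nat) (g : 'M[R[i]]_k), g \in unitmx ->
    forall p, I p -> I (gl_act g p).

Definition irrelevant (R : realType) (n : nat) : set (polyA R n) :=
  smallest (@ideal R n) (range (@varA R n)).

(* The free module on a basis [B], as finitely supported functions from [B] to
   [A_n]; it is graded by assigning a degree [deg b] to each basis element. *)
Notation freeA R n B := {malg (polyA R n)[B]}.

Definition homogF (R : realType) (n : nat) (B : choiceType) (deg : B -> int)
    (j : int) (x : freeA R n B) : Prop :=
  forall b, homogA (j - deg b) (mcoeff b x).

(* The submodule m F of a free module F, for m the irrelevant ideal, so that
   F / m F is the tensor product of F with C = A_n / m. *)
Definition irrelevantF (R : realType) (n : nat) (B : choiceType) :
    set (freeA R n B) :=
  [set x | forall b, irrelevant (mcoeff b x)].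

(* A resolution ... -> F_1 -> F_0 -> I -> 0 of the ideal I by graded free
   modules F_i and degree-preserving maps. *)
Record free_resolution (R : realType) (n : nat) (I : set (polyA R n)) := {
  res_basis : nat -> choiceType;
  res_deg : forall i, res_basis i -> int;
  res_d : forall i,
    {linear freeA R n (res_basis i.+1) -> freeA R n (res_basis i)};
  res_aug : {linear freeA R n (res_basis 0%N) -> (polyA R n)^o};
  res_d_homog : forall i j x,
    homogF (@res_deg i.+1) j x -> homogF (@res_deg i) j (res_d i x);
  res_aug_homog : forall j x,
    homogF (@res_deg 0%N) j x -> homogA j (res_aug x);
  res_aug_range : range res_aug = I;
  res_exact0 : range (res_d 0%N) = [set x | res_aug x = 0];
  res_exactS : forall i, range (res_d i.+1) = [set x | res_d i x = 0]
}.

(* The cycles of F / m F in homological degree i, lifted to F_i. *)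
Definition tor_cycle (R : realType) (n : nat) (I : set (polyA R n))
    (F : free_resolution I) (i : nat) : set (freeA R n (res_basis F i)) :=
  match i with
  | 0%N => setT
  | k.+1 => [set x | irrelevantF (res_d F k x)]
  end.

Definition tor_boundary (R : realType) (n : nat) (I : set (polyA R n))
    (F : free_resolution I) (i : nat) : set (freeA R n (res_basis F i)) :=
  [set x | exists y, irrelevantF (x - res_d F i y)].

(* Tor_i(I, C)_j <> 0: the homology of F / m F at i has a nonzero class of
   degree j, for a graded free resolution F of I (up to isomorphism this
   homology does not depend on the choice of F). *)
Definition tor_neq0 (R : realType) (n : nat) (I : set (polyA R n))
    (i : nat) (j : int) : Prop :=
  exists (F : free_resolution I) (x : freeA R n (res_basis F i)),
    [/\ homogF (@res_deg _ _ _ F i) j x, tor_cycle x & ~ tor_boundary x].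

Definition regularity (R : realType) (n : nat) (I : set (polyA R n)) : \bar R :=
  ereal_sup [set ((ij.2 - ij.1%:Z)%:~R)%:E |
             ij in [set ij : nat * int | tor_neq0 I ij.1 ij.2]].

(* Main.v *)
Require Import Defs.
From HB Require Import structures.
From mathcomp Require Import all_boot all_order all_algebra.
From mathcomp Require Import finmap monalg complex.
From mathcomp Require Import boolp classical_sets functions reals ereal.
From mathcomp Require Import zify.

Set Implicit Arguments.
Unset Strict Implicit.
Unset Printing Implicit Defensive.

Import Order.TTheory GRing.Theory Num.Theory.
Local Open Scope classical_set_scope.
Local Open Scope ring_scope.

(** For every [n], take the single quadric [f = sum_i x_(i,0)^2] in [A_n], so
    that [d = 2] and [r = 1] throughout.  The GL-ideal [I] that it generates is
    the ideal of the Gram polynomials [f_ab = sum_i x_(i,a) x_(i,b)]: it says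
    that the columns of the generic matrix are isotropic and pairwise
    orthogonal.  The claim is that [Tor_(n-1)(I, C)] is nonzero in degree
    [2 n]; hence the regularity of [I] is at least [n + 1], and no bound
    [N 2 1] can hold for all [n].

    The reason is a specialization.  Let [sigma] kill every variable off the
    diagonal.  It maps [f_kk] to [x_(k,k)^2] for [k < n] and all other Gram
    polynomials to 0, so [A_n / I] specializes to a complete intersection
    cut out by the squares of [n] variables, which is resolved by a Koszul
    complex [T].  The product [f_00, ..., f_(n-1,n-1)] of [n] classes in
    [Tor_1(A_n / I, C)_2] is a class in [Tor_n(A_n / I, C)_(2n)], and it is
    nonzero because its image is the class of the top generator of [T].

    To turn this into a proof, a free resolution [F] of [I] is built together
    with a comparison map to [T].  One starts from [A_n] and repeatedly takes as
    a basis of the next module all pairs of a homogeneous cycle [z] and an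
    element [w] of [T], of positive homological degree, that bounds the image
    of [z]; exactness of [T] in positive degrees ([koszul_exact]) shows that
    every homogeneous cycle occurs, and the comparison map sends the pair to
    [w].  Since [f_kk] lies in [I], multiplication by it is null-homotopic on
    the resolution, and the pairs allow one to choose homotopies [h_k] that
    the comparison map carries to exterior multiplication by the [k]-th
    generator of [T].  The element [h_(n-1) ... h_0 1] has homological degree
    [n - 1] over [I] and internal degree [2 n].  It is a cycle modulo the
    irrelevant ideal, since [d h_k = f_kk - h_k d], and it maps to the top
    generator of [T].  A boundary maps to a boundary of [T], whose top
    coefficient vanishes, so the element is not a boundary modulo the
    irrelevant ideal ([tower_tor]). *)

(** * Linear maps out of free modules *)

Lemma malg_ind (K : choiceType) (G : zmodType) (P : {malg G[K]} -> Prop) :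
  P 0 -> (forall g h, P g -> P h -> P (g + h)) ->
  (forall c k, P << c *g k >>) -> forall g, P g.
Proof.
move=> P0 PD PU g; rewrite (monalgE g); apply: big_ind => // k _; exact: PU.
Qed.

Lemma scale_malgU (K : choiceType) (G : nzRingType) (c : G) (k : K) :
  c *: << k >> = << c *g k >> :> {malg G[K]}.
Proof. by apply/malgP => l; rewrite mcoeffZ !mcoeffU mulrnAr mulr1. Qed.

Section LinearExtension.
Variables (K : choiceType) (A B : nzRingType) (nu : {rmorphism A -> B}).
Variables (V : lmodType B) (w : K -> V).

(** The [nu]-semilinear map that sends the basis element [k] to [w k]. *)
Definition lext (g : {malg A[K]}) : V := \sum_(k <- msupp g) nu g@_k *: w k.

Lemma lextEw (d : {fset K}) g : (msupp g `<=` d)%fset ->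
  lext g = \sum_(k <- d) nu g@_k *: w k.
Proof.
move=> le; rewrite /lext (big_fset_incl _ le) // => k _ kg.
by rewrite mcoeff_outdom // rmorph0 scale0r.
Qed.

Lemma lext_is_zmod_morphism : zmod_morphism lext.
Proof.
move=> g h.
rewrite (@lextEw (msupp g `|` msupp h)%fset (g - h)) ?msuppB_le//.
rewrite (@lextEw (msupp g `|` msupp h)%fset g) ?fsubsetUl//.
rewrite (@lextEw (msupp g `|` msupp h)%fset h) ?fsubsetUr//.
rewrite -sumrB; apply: eq_bigr => k _.
by rewrite mcoeffB rmorphB scalerBl.
Qed.

HB.instance Definition _ :=
  GRing.isZmodMorphism.Build {malg A[K]} V lext lext_is_zmod_morphism.

Lemma lextU c k : lext << c *g k >> = nu c *: w k.
Proof.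
rewrite (@lextEw [fset k]%fset) ?msuppU_le// big_seq_fset1.
by rewrite mcoeffUU.
Qed.

Lemma lextZ c g : lext (c *: g) = nu c *: lext g.
Proof.
rewrite (@lextEw (msupp g)) ?msuppZ_le// scaler_sumr.
by apply: eq_bigr => k _; rewrite mcoeffZ rmorphM scalerA.
Qed.

End LinearExtension.

Section LinearExtensionId.
Variables (K : choiceType) (A : nzRingType) (V : lmodType A) (w : K -> V).
(** This case is kept apart from [lext] because a resolution requires
    differentials that are linear for the scaling of the module itself. *)
Definition lmap : {malg A[K]} -> V := lext idfun w.

Lemma lmap_is_linear : linear lmap.
Proof. by move=> c x y; rewrite /lmap raddfD /= lextZ. Qed.

HB.instance Definition _ :=
  GRing.isLinear.Build A {malg A[K]} V *:%R lmap lmap_is_linear.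

Lemma lmapU c k : lmap << c *g k >> = c *: w k.
Proof. exact: lextU. Qed.

Lemma lmapZ c x : lmap (c *: x) = c *: lmap x.
Proof. exact: lextZ. Qed.
End LinearExtensionId.

Section LextComp.
Variables (K L : choiceType) (A B : nzRingType) (nu : {rmorphism A -> B}).
Variables (V : lmodType B).

Lemma lext_lmap (v : L -> V) (w : K -> {malg A[L]}) x :
  lext nu v (lmap w x) = lext nu (fun b => lext nu v (w b)) x.
Proof.
elim/malg_ind: x => [|x y IHx IHy|c k]; first by rewrite !raddf0.
  by rewrite !raddfD /= IHx IHy.
by rewrite lextU lmapU lextZ.
Qed.

Lemma linear_lext (W : lmodType B) (phi : {linear V -> W}) (v : K -> V) x :
  phi (lext nu v x) = lext nu (fun b => phi (v b)) x.
Proof.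
by rewrite /lext linear_sum; apply: eq_bigr => k _; rewrite linearZ.
Qed.
End LextComp.

Section LmapComp.
Variables (K L : choiceType) (A : nzRingType) (V : lmodType A).

Lemma lmap_lmap (v : L -> V) (w : K -> {malg A[L]}) x :
  lmap v (lmap w x) = lmap (fun b => lmap v (w b)) x.
Proof. exact: lext_lmap. Qed.

Lemma eq_lmap (v w : K -> V) : v =1 w -> lmap v =1 lmap w.
Proof. by move=> vw x; apply: eq_bigr => k _; rewrite vw. Qed.

Lemma mcoeff_lmap (w : K -> {malg A[L]}) x b :
  mcoeff b (lmap w x) = \sum_(k <- msupp x) mcoeff k x * mcoeff b (w k).
Proof.
by rewrite raddf_sum; apply: eq_bigr => k _; rewrite /= mcoeffZ.
Qed.
End LmapComp.

(** * Koszul complexes as iterated mapping cones *)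
Section Koszul.
Variables (A : comNzRingType) (a : nat -> A).

(** The total module of the Koszul complex on [a 0, ..., a (k - 1)].  In the
    cone of multiplication by [a k] on the complex [K], the pair [(u, v)]
    stands for [u + e_k v]; this avoids the signs of an exterior algebra on
    [k] generators, and the homological grading is not recorded. *)
Fixpoint koszul (k : nat) : lmodType A :=
  if k is k'.+1 then (koszul k' * koszul k')%type else A^o.

Fixpoint koszul_d k : koszul k -> koszul k :=
  match k with
  | 0 => fun=> 0
  | k'.+1 => fun t => (koszul_d t.1 + a k' *: t.2, - koszul_d t.2)
  end.

(** Exterior multiplication by the generator [e_j], meaningful for [j < k]. *)
Fixpoint koszul_e j k : koszul k -> koszul k :=
  match k with
  | 0 => fun=> 0
  | k'.+1 => fun t => 
      if j == k' then (0, t.1) else (koszul_e j t.1, - koszul_e j t.2)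
  end.

(** The elements with no component in homological degree 0. *)
Fixpoint koszul_pos k : koszul k -> Prop :=
  match k with
  | 0 => fun t => t = 0
  | k'.+1 => fun t => koszul_pos t.1
  end.

Fixpoint koszul_one k : koszul k :=
  match k with
  | 0 => (1 : A)
  | k'.+1 => (koszul_one k', 0)
  end.

(** The coefficient of the product of all generators. *)
Fixpoint koszul_top k : koszul k -> A :=
  match k with
  | 0 => id
  | k'.+1 => fun t => koszul_top t.2
  end.

Lemma koszul_d_is_linear k : linear (@koszul_d k).
Proof.
elim: k => [|k IH] c t u /=; first by rewrite scaler0 addr0.
rewrite !IH; congr pair; rewrite /= ?scalerDr ?scalerA.
  by rewrite addrACA [a k * c]mulrC.
by rewrite opprD scalerN.
Qed.

HB.instance Definition _ k :=
  GRing.isLinear.Build A (koszul k) (koszul k) *:%R (@koszul_d k)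
    (@koszul_d_is_linear k).

Lemma koszul_e_is_linear j k : linear (@koszul_e j k).
Proof.
elim: k => [|k IH] c t u /=; first by rewrite scaler0 addr0.
case: eqP => _.
  by congr pair; rewrite //= scaler0 addr0.
by rewrite !IH; congr pair; rewrite /= ?opprD ?scalerN.
Qed.

HB.instance Definition _ j k :=
  GRing.isLinear.Build A (koszul k) (koszul k) *:%R (@koszul_e j k)
    (@koszul_e_is_linear j k).

Lemma koszul_top_is_linear k : linear (@koszul_top k : koszul k -> A^o).
Proof. by elim: k => [|k IH] c t u //=; rewrite IH. Qed.

HB.instance Definition _ k :=
  GRing.isLinear.Build A (koszul k) A^o *:%R (@koszul_top k)
    (@koszul_top_is_linear k).

Lemma koszul_homotopy j k (t : koszul k) : (j < k)%N ->
  koszul_d (koszul_e j t) + koszul_e j (koszul_d t) = a j *: t.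
Proof.
elim: k t => [|k IH] // [u v] /=; rewrite ltnS leq_eqVlt.
have [-> _|jk /= lt_jk] := eqVneq j k.
  rewrite /=; congr pair; rewrite /=.
    by rewrite linear0 add0r addr0.
  by rewrite addrA addNr add0r.
congr pair; rewrite /=.
  rewrite linearD linearZ /= scalerN addrACA addNr addr0.
  exact: IH.
by rewrite linearN /= opprK linearN /= opprK IH.
Qed.

Lemma koszul_pos0 k : @koszul_pos k 0.
Proof. by elim: k. Qed.

Lemma koszul_pos_linear k c (t u : koszul k) :
  koszul_pos t -> koszul_pos u -> koszul_pos (c *: t + u).
Proof.
elim: k t u => [|k IH] t u /=; last exact: IH.
by move=> -> ->; rewrite scaler0 addr0.
Qed.

Lemma koszul_pos_e j k (t : koszul k) : koszul_pos (koszul_e j t).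
Proof.
elim: k t => [|k IH] //= t; case: eqP => _ /=; [exact: koszul_pos0|exact: IH].
Qed.

Lemma koszul_d_one k : koszul_d (koszul_one k) = 0.
Proof. by elim: k => [|k IH] //=; rewrite IH scaler0 addr0 linear0 oppr0. Qed.

(** A differential lowers the homological degree, so it never reaches the top
    generator. *)
Lemma koszul_top_d k (t : koszul k) : koszul_top (koszul_d t) = 0.
Proof. by elim: k t => [|k IH] t //=; rewrite linearN /= IH oppr0. Qed.

(** The product [e_(m-1) ... e_0] in the complex on [k] elements. *)
Fixpoint koszul_chain k m : koszul k :=
  if m is m'.+1 then koszul_e m' (koszul_chain k m') else koszul_one k.

Lemma koszul_chainS k m : (m <= k)%N ->
  koszul_chain k.+1 m = (koszul_chain k m, 0).
Proof.
elim: m => [|m IH] // mk.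
by rewrite /= IH ?(ltnW mk)// ltn_eqF //= linear0 oppr0.
Qed.

Lemma koszul_top_chain k : koszul_top (koszul_chain k k) = 1.
Proof.
elim: k => [|k IH] //; rewrite [koszul_chain _ _]/= koszul_chainS// eqxx /=.
exact: IH.
Qed.

Section Exactness.
(** Additive operators dividing by each [a k] and linear over the other [a j]
    force the sequence to be regular; monomials of a polynomial ring have
    them. *)
Variable D : nat -> {additive A -> A}.
Hypothesis DaK : forall k p, D k (a k * p) = p.
Hypothesis Da : forall j k p, j != k -> D k (a j * p) = a j * D k p.

Fixpoint koszul_div j k : koszul k -> koszul k :=
  match k with
  | 0 => D j
  | k'.+1 => fun t => (koszul_div j t.1, koszul_div j t.2)
  end.

Lemma koszul_divB j k (t u : koszul k) :
  koszul_div j (t - u) = koszul_div j t - koszul_div j u.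
Proof.
elim: k t u => [|k IH] t u; first exact: (raddfB (D j)).
by rewrite /= !IH.
Qed.

Lemma koszul_div0 j k : koszul_div j (0 : koszul k) = 0.
Proof. by have := koszul_divB j (0 : koszul k) 0; rewrite !subrr. Qed.

Lemma koszul_divN j k (t : koszul k) : koszul_div j (- t) = - koszul_div j t.
Proof. by rewrite -[- t]sub0r koszul_divB koszul_div0 sub0r. Qed.

Lemma koszul_divD j k (t u : koszul k) :
  koszul_div j (t + u) = koszul_div j t + koszul_div j u.
Proof. by rewrite -[u in LHS]opprK koszul_divB koszul_divN opprK. Qed.

Lemma koszul_divZK k m (t : koszul m) : koszul_div k (a k *: t) = t.
Proof.
elim: m t => [|m IH] t; first exact: DaK.
by case: t => u v; rewrite /= !IH.
Qed.

Lemma koszul_divZ j k m (t : koszul m) : j != k ->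
  koszul_div k (a j *: t) = a j *: koszul_div k t.
Proof.
move=> jk; elim: m t => [|m IH] t; first exact: Da.
by case: t => u v; rewrite /= !IH.
Qed.

Lemma koszul_div_d k m (t : koszul m) : (m <= k)%N ->
  koszul_div k (koszul_d t) = koszul_d (koszul_div k t).
Proof.
elim: m t => [|m IH] t mk; first exact: (raddf0 (D k)).
by rewrite /= koszul_divD koszul_divN !IH ?(ltnW mk)// koszul_divZ // ltn_eqF.
Qed.

Lemma koszul_pos_div j k (t : koszul k) :
  koszul_pos t -> koszul_pos (koszul_div j t).
Proof.
elim: k t => [|k IH] t /=; last exact: IH.
by move=> ->; exact: (raddf0 (D j)).
Qed.

(** If [(u, v)] is a cycle of the cone then [d u = - a v].  Dividing by [a]
    gives [d (D u) = - v], so subtracting the boundary of [(0, D u)] leaves the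
    cycle [u - a (D u)] of the shorter complex, to which induction applies. *)
Lemma koszul_exact k (t : koszul k) : koszul_pos t -> koszul_d t = 0 ->
  exists2 s, koszul_pos s & koszul_d s = t.
Proof.
elim: k t => [|k IH] t; first by move=> /= ->; exists 0.
case: t => u v /= upos; case=> duv /eqP; rewrite oppr_eq0 => /eqP dv.
pose r := koszul_div k u.
have dr : koszul_d r = - v.
  rewrite -koszul_div_d//; move/eqP: duv; rewrite addr_eq0 => /eqP ->.
  by rewrite koszul_divN koszul_divZK.
have [|| s spos ds] := IH (u - a k *: r).
- rewrite addrC -scaleNr; apply: koszul_pos_linear => //; exact: koszul_pos_div.
- by rewrite linearB linearZ /= dr scalerN opprK.
by exists (s, r) => //=; rewrite ds dr opprK subrK.
Qed.

End Exactness.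
End Koszul.

(** * Gradings *)

(** A grading by [int], presented by its homogeneous elements [H] and its
    component maps [comp]; [homog_ind] says that the homogeneous elements
    span. *)
Record grading (G : zmodType) (H : int -> G -> Prop) (comp : int -> G -> G) :
  Prop := Grading {
  compD : forall j x y, comp j (x + y) = comp j x + comp j y;
  comp_id : forall j x, H j x -> comp j x = x;
  comp_ne : forall i j x, H i x -> i != j -> comp j x = 0;
  comp_homog : forall j x, H j (comp j x);
  homog_ind : forall P : G -> Prop, P 0 ->
    (forall x y, P x -> P y -> P (x + y)) ->
    (forall i x, H i x -> P x) -> forall x, P x
}.

Section Gradings.
Variables (G : zmodType) (H : int -> G -> Prop) (comp : int -> G -> G).
Hypothesis gr : grading H comp.

Lemma comp0 j : comp j 0 = 0.
Proof.
by have := compD gr j 0 0; rewrite addr0 -{1}[comp j 0]addr0 => /addrI.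
Qed.

(** Maps of degree [e] commute with taking components, because they do so on
    homogeneous elements. *)
Lemma comp_map (G' : zmodType) (H' : int -> G' -> Prop) comp'
    (phi : {additive G -> G'}) (e : int) : grading H' comp' ->
    (forall i x, H i x -> H' (i + e) (phi x)) ->
  forall j x, comp' (j + e) (phi x) = phi (comp j x).
Proof.
move=> gr' hphi j x; elim/(homog_ind gr): x => [|x y IHx IHy|i x hx].
- rewrite comp0 !raddf0.
  have := compD gr' (j + e) 0 0.
  by rewrite addr0 -{1}[comp' _ 0]addr0 => /addrI.
- by rewrite raddfD /= (compD gr) (compD gr') IHx IHy raddfD.
have [ij|ij] := eqVneq i j.
  by rewrite -ij (comp_id gr)// (comp_id gr')//; apply: hphi.
rewrite (comp_ne gr hx)// raddf0 (comp_ne gr' (hphi _ _ hx))//.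
by apply: contra ij => /eqP /addIr ->.
Qed.

(** Stated for all large enough [D'], so that the decompositions of two elements
    can be added. *)
Lemma comp_sum x : exists D : {fset int}, forall D' : {fset int},
  (D `<=` D')%fset -> x = \sum_(j <- D') comp j x.
Proof.
elim/(homog_ind gr): x => [|x y [Dx hx] [Dy hy]|i x hx].
- by exists fset0 => D' _; rewrite big1 // => j _; rewrite comp0.
- exists (Dx `|` Dy)%fset => D'; rewrite fsubUset => /andP[sx sy].
  rewrite {1}(hx _ sx) {1}(hy _ sy) -big_split; apply: eq_bigr => j _.
  by rewrite /= (compD gr).
exists [fset i]%fset => D'; rewrite fsub1set => iD.
rewrite (big_fsetD1 i)//= (comp_id gr)// big_seq big1 ?addr0// => j.
by rewrite in_fsetD1 => /andP[ji _]; rewrite (comp_ne gr hx)// eq_sym.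
Qed.

Lemma comp_ind (P : G -> Prop) x : P 0 ->
  (forall y z, P y -> P z -> P (y + z)) -> (forall j, P (comp j x)) -> P x.
Proof.
move=> P0 PD Pc; have [D hD] := comp_sum x; rewrite (hD D)//.
by apply: big_ind => // j _; exact: Pc.
Qed.
End Gradings.

(** * Homogeneous polynomials, graded free modules and ideals *)

Section HomogA.
Variables (R : realType) (n : nat).
Notation A := (polyA R n).
Implicit Types (p q : A).

Lemma homogA0 j : homogA j (0 : A).
Proof. by move=> m; rewrite msupp0 in_fset0. Qed.

Lemma homogAD j p q : homogA j p -> homogA j q -> homogA j (p + q).
Proof.
move=> hp hq m /(fsubsetP (msuppD_le _ _)); rewrite in_fsetU => /orP[].
  exact: hp.
exact: hq.
Qed.

Lemma homogAN j p : homogA j p -> homogA j (- p).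
Proof. by move=> hp m; rewrite msuppN; exact: hp. Qed.

Lemma homogA_sum j (T : Type) (s : seq T) (P : pred T) (F : T -> A) :
  (forall t, P t -> homogA j (F t)) -> homogA j (\sum_(t <- s | P t) F t).
Proof. by move=> hF; apply: big_ind => //; [exact: homogA0|exact: homogAD]. Qed.

Lemma homogAM i j p q : homogA i p -> homogA j q -> homogA (i + j) (p * q).
Proof.
move=> hp hq m /msuppM_le[m1 [m2 [m1p m2q ->]]].
by rewrite mdegM PoszD (hp _ m1p) (hq _ m2q).
Qed.

Lemma homogAU (c : R[i]) m : homogA (mdeg m)%:Z (<< c *g m >> : A).
Proof. by move=> m' /(fsubsetP msuppU_le); rewrite in_fset1 => /eqP ->. Qed.

Lemma homogA1 : homogA 0 (1 : A).
Proof. by have := @homogAU 1 mone; rewrite mdeg1. Qed.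

Definition compA (j : int) p : A :=
  [malg m in msupp p => p@_m *+ ((mdeg m)%:Z == j)].

Lemma mcoeff_compA j p m : (compA j p)@_m = p@_m *+ ((mdeg m)%:Z == j).
Proof. by rewrite mcoeffE; case: msuppP; rewrite ?mul0rn. Qed.

Lemma homogAP j p : homogA j p <-> forall m, (mdeg m)%:Z != j -> p@_m = 0.
Proof.
split=> [hp m|hp m]; first by case: msuppP => // /hp ->; rewrite eqxx.
by rewrite -mcoeff_neq0; apply: contraNeq => /hp ->.
Qed.

Lemma gradingA : grading (@homogA R n) compA.
Proof.
split.
- move=> j p q; apply/malgP => m.
  by rewrite mcoeffD !mcoeff_compA mcoeffD mulrnDl.
- move=> j p /homogAP hp; apply/malgP => m; rewrite mcoeff_compA.
  by case: eqVneq => [//|/hp ->].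
- move=> i j p /homogAP hp ij; apply/malgP => m; rewrite mcoeff_compA mcoeff0.
  by case: eqVneq => [mj|//]; rewrite hp ?mul0rn// mj eq_sym.
- by move=> j p; apply/homogAP => m /negPf mj; rewrite mcoeff_compA mj.
- move=> P P0 PD Ph; apply: (malg_ind P0 PD) => c m.
  apply: (Ph (mdeg m)%:Z); exact: homogAU.
Qed.

Section HomogF.
Variables (B : choiceType) (deg : B -> int).
Implicit Types (x y : freeA R n B).

Lemma homogFD j x y : homogF deg j x -> homogF deg j y -> homogF deg j (x + y).
Proof. by move=> hx hy b; rewrite mcoeffD; apply: homogAD. Qed.

Lemma homogFN j x : homogF deg j x -> homogF deg j (- x).
Proof. by move=> hx b; rewrite mcoeffN; apply: homogAN. Qed.

Lemma homogFZ e j p x :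
  homogA e p -> homogF deg j x -> homogF deg (j + e) (p *: x).
Proof.
by move=> hp hx b; rewrite mcoeffZ addrAC addrC; apply: homogAM.
Qed.

Lemma homogFU e p b : homogA e p -> homogF deg (deg b + e) << p *g b >>.
Proof.
move=> hp b'; rewrite mcoeffU; case: eqP => [<-|_]; last exact: homogA0.
by rewrite addrC addKr.
Qed.

Definition compF (j : int) x : freeA R n B :=
  [malg b in msupp x => compA (j - deg b) x@_b].

Lemma mcoeff_compF j x b : (compF j x)@_b = compA (j - deg b) x@_b.
Proof. by rewrite mcoeffE; case: msuppP => // _; rewrite (comp0 gradingA). Qed.

Lemma gradingF : grading (homogF deg) compF.
Proof.
split.
- move=> j x y; apply/malgP => b.
  by rewrite mcoeffD !mcoeff_compF mcoeffD (compD gradingA).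
- by move=> j x hx; apply/malgP => b; rewrite mcoeff_compF (comp_id gradingA).
- move=> i j x hx ij; apply/malgP => b.
  rewrite mcoeff_compF mcoeff0 (comp_ne gradingA (hx b))//.
  by apply: contra ij => /eqP /addIr ->.
- by move=> j x b; rewrite mcoeff_compF; exact: (comp_homog gradingA).
- move=> P P0 PD Ph; apply: (malg_ind P0 PD) => c b.
  elim/(homog_ind gradingA): c => [|p q Pp Pq|i p hp].
    by rewrite monalgU0.
    by rewrite monalgUD; apply: PD.
  by apply: (Ph (deg b + i)); exact: homogFU.
Qed.
End HomogF.

Lemma homogF_lmap (B B' : choiceType) (deg : B -> int) (deg' : B' -> int) e
    (w : B -> freeA R n B') j x :
  (forall b, homogF deg' (deg b + e) (w b)) ->
  homogF deg j x -> homogF deg' (j + e) (lmap w x).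
Proof.
move=> hw hx b'; rewrite mcoeff_lmap; apply: homogA_sum => b _.
have := homogAM (hx b) (hw b b').
by rewrite addrA addrA subrK.
Qed.

Lemma smallest_ideal (S : set A) : ideal (smallest (@ideal R n) S).
Proof.
split; first by move=> J [[]].
move=> a p q Ip Iq J SJ; have [[_ Jl] _] := SJ.
by apply: Jl; [apply: Ip; exact: SJ|apply: Iq; exact: SJ].
Qed.

Lemma idealMl (I : set A) a p : ideal I -> I p -> I (a * p).
Proof. by move=> [I0 Il] Ip; rewrite -[_ * _]addr0; apply: Il. Qed.

Lemma idealMr (I : set A) a p : ideal I -> I p -> I (p * a).
Proof. by rewrite mulrC; exact: idealMl. Qed.

Lemma idealD (J : set A) p q : ideal J -> J p -> J q -> J (p + q).
Proof. by move=> [_ Jl] Jp Jq; have := Jl 1 _ _ Jp Jq; rewrite mul1r. Qed.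

Lemma ideal_preimage (phi : {rmorphism A -> A}) (J : set A) :
  ideal J -> ideal [set p | J (phi p)].
Proof.
move=> [J0 Jl]; split=> [|a p q Jp Jq] /=; first by rewrite rmorph0.
by rewrite rmorphD rmorphM; apply: Jl.
Qed.

Lemma ideal_sum (I : set A) (T : Type) (s : seq T) (P : pred T) (F : T -> A) :
  ideal I -> (forall t, P t -> I (F t)) -> I (\sum_(t <- s | P t) F t).
Proof.
by move=> Ii hF; apply: big_ind => //; [exact: Ii.1|move=> p q; exact: idealD].
Qed.

Lemma irrelevant_ideal : ideal (@irrelevant R n).
Proof. exact: smallest_ideal. Qed.

Lemma irrelevantF_lmap (B B' : choiceType) (w : B -> freeA R n B') x :
  irrelevantF x -> irrelevantF (lmap w x).
Proof.
move=> hx b; rewrite mcoeff_lmap; apply: ideal_sum => [|k _].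
  exact: irrelevant_ideal.
exact: idealMr irrelevant_ideal (hx k).
Qed.
End HomogA.
Arguments gradingA {R n}.
Arguments gradingF {R n B} deg.

(** * A free resolution with a comparison map *)

Section Tower.
(** The comparison map with target [T] is semilinear over [sigma]; the set [pos]
    plays the part of the elements of positive homological degree and [one]
    that of the generator in degree 0, so that [liftI] makes [sigma p] bound
    for [p] in [I].  The operator [E k] is a homotopy for multiplication by
    [sigma (f k)]. *)
Variables (R : realType) (n : nat).
Notation A := (polyA R n).
Variables (I : set A) (sigma : {rmorphism A -> A}).
Variables (T : lmodType A) (dT : {linear T -> T}) (pos : T -> Prop) (one : T).
Variables (X : Type) (f : X -> A) (E : X -> {linear T -> T}).
Hypothesis I_ideal : ideal I.
Hypothesis I_graded : forall j p, I p -> I (compA j p).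
Hypothesis fI : forall k, I (f k).
Hypothesis f_homog : forall k, homogA 2%:Z (f k).
Hypothesis f_irr : forall k, irrelevant (f k).
Hypothesis pos0 : pos 0.
Hypothesis pos_linear : forall c t u, pos t -> pos u -> pos (c *: t + u).
Hypothesis pos_E : forall k t, pos (E k t).
Hypothesis exactT : forall t, pos t -> dT t = 0 -> exists2 s, pos s & dT s = t.
Hypothesis homotopy : forall k t, dT (E k t) + E k (dT t) = sigma (f k) *: t.
Hypothesis d_one : dT one = 0.
Hypothesis liftI : forall p, I p -> exists2 w, pos w & dT w = sigma p *: one.

Lemma pos_lext (K : choiceType) (v : K -> T) x :
  (forall b, pos (v b)) -> pos (lext sigma v x).
Proof.
move=> vpos; rewrite /lext; apply: big_ind => // [t u tp up|b _].
  by have := pos_linear 1 tp up; rewrite scale1r.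
by rewrite -[_ *: _]addr0; apply: pos_linear.
Qed.

(** One free module of the resolution.  The set [cyc] is the kernel of the
    differential out of it, [wval] gives the comparison map on the basis, and
    [zeta k] is [f k - h_k d] for the homotopy [h_k] that starts on the previous
    module; [zeta k b] is the cycle that the homotopy out of this module
    must make the boundary of the image of [b].  Recording [zeta] rather than
    [h_k] makes a stage independent of the previous one. *)
Record stage := Stage {
  bas : choiceType;
  sdeg : bas -> int;
  cyc : set (freeA R n bas);
  wval : bas -> T;
  zeta : X -> bas -> freeA R n bas;
  cyc0 : cyc 0;
  cyc_linear : forall c x y, cyc x -> cyc y -> cyc (c *: x + y);
  cyc_comp : forall j x, cyc x -> cyc (compF sdeg j x);
  cyc_lift : forall z, cyc z -> exists2 w, pos w & dT w = lext sigma wval z;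
  zeta_homog : forall k b, homogF sdeg (sdeg b + 2%:Z) (zeta k b);
  zeta_cyc : forall k b, cyc (zeta k b);
  zeta_val : forall k b, lext sigma wval (zeta k b) = dT (E k (wval b));
  zeta_on_cyc : forall k z, cyc z -> lmap (zeta k) z = f k *: z
}.

(** A basis element of the next module: a homogeneous cycle together with a
    choice of its value in [T].  Taking all such pairs makes the next module
    contain every element that will be needed, with the value needed. *)
Record cell (s : stage) := Cell {
  cdeg : int;
  cbd : freeA R n (bas s);
  cval : T;
  cbd_homog : homogF (@sdeg s) cdeg cbd;
  cbd_cyc : cyc cbd;
  cval_pos : pos cval;
  d_cval : dT cval = lext sigma (@wval s) cbd
}.

HB.instance Definition _ s := gen_eqMixin (cell s).
HB.instance Definition _ s := gen_choiceMixin (cell s).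

Section Next.
Variable s : stage.

Definition cell_bd : freeA R n (cell s) -> freeA R n (bas s) := lmap (@cbd s).
HB.instance Definition _ := GRing.Linear.on cell_bd.

(** The homotopy [h_k] from the module of [s] to the next one. *)
Definition raise k (b : bas s) : freeA R n (cell s) :=
  << Cell (@zeta_homog s k b) (@zeta_cyc s k b) (pos_E k (wval b))
       (esym (zeta_val k b)) >>.

Lemma cell_bd_raise k x : cell_bd (lmap (raise k) x) = lmap (zeta k) x.
Proof.
rewrite /cell_bd lmap_lmap; apply: eq_lmap => b.
by rewrite lmapU scale1r.
Qed.

Lemma val_raise k x :
  lext sigma (@cval s) (lmap (raise k) x) = E k (lext sigma (@wval s) x).
Proof.
rewrite lext_lmap linear_lext; apply: eq_bigr => b _.
by rewrite lextU rmorph1 scale1r.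
Qed.

Lemma raise_homog k j x : homogF (@sdeg s) j x ->
  homogF (@cdeg s) (j + 2%:Z) (lmap (raise k) x).
Proof.
apply: homogF_lmap => b; rewrite -[_ + _]addr0.
apply: (@homogFU _ _ _ (@cdeg s) 0 1 (Cell _ _ _ _)).
exact: homogA1.
Qed.

Lemma val_cell_bd x :
  lext sigma (@wval s) (cell_bd x) = dT (lext sigma (@cval s) x).
Proof.
rewrite lext_lmap linear_lext; apply: eq_bigr => c _.
by rewrite -d_cval.
Qed.

Lemma cell_bd_homog j x :
  homogF (@cdeg s) j x -> homogF (@sdeg s) j (cell_bd x).
Proof.
move=> hx; rewrite -[j]addr0; apply: homogF_lmap hx => c.
by rewrite addr0; exact: cbd_homog.
Qed.

Lemma cyc_cell_bd x : cyc (cell_bd x).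
Proof.
rewrite /cell_bd /lmap /lext; apply: big_ind => [|u v cu cv|c _].
- exact: cyc0.
- by have := cyc_linear 1 cu cv; rewrite scale1r.
by rewrite -[_ *: _]addr0; apply: cyc_linear; [exact: cbd_cyc|exact: cyc0].
Qed.

(** A cycle is the sum of its components, which are cycles, and each component is
    the boundary of a cell because its value bounds in [T]. *)
Lemma range_cell_bd : range cell_bd = cyc (s := s).
Proof.
apply/seteqP; split=> [_ [x _ <-]|z]; first exact: cyc_cell_bd.
move=> cz; apply: (@comp_ind _ _ _ (gradingF (@sdeg s)) (range cell_bd) z)
  => [|_ _ [x _ <-] [y _ <-]|j].
- by exists 0 => //; exact: linear0.
- by exists (x + y) => //; exact: linearD.
have [w wpos dw] := cyc_lift (cyc_comp j cz).
pose c := Cell (comp_homog (gradingF (@sdeg s)) j z) (cyc_comp j cz) wpos dw.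
by exists << c >> => //; rewrite /cell_bd lmapU scale1r.
Qed.

Definition next_zeta k (c : cell s) : freeA R n (cell s) :=
  f k *: << c >> - lmap (raise k) (cbd c).

Lemma lmap_next_zeta k x :
  lmap (next_zeta k) x = f k *: x - lmap (raise k) (cell_bd x).
Proof.
elim/malg_ind: x => [|x y IHx IHy|p c].
- by rewrite linear0 scaler0 linear0 linear0 subrr.
- by rewrite linearD /= IHx IHy scalerDr linearD linearD /= opprD addrACA.
rewrite lmapU.
have -> : cell_bd << p *g c >> = p *: cbd c by exact: lmapU.
rewrite lmapZ /next_zeta [LHS]scalerBr.
have -> // : f k *: << p *g c >> = p *: (f k *: << 1 *g c >>)
  :> freeA R n (cell s).
rewrite !scalerA [p * f k]mulrC -scalerA.
by have -> : << p *g c >> = p *: << 1 *g c >> :> freeA R n (cell s)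
  by rewrite scale_malgU.
Qed.

Lemma next_cyc_linear c x y :
  cell_bd x = 0 -> cell_bd y = 0 -> cell_bd (c *: x + y) = 0.
Proof. by move=> x0 y0; rewrite linearP /= x0 y0 scaler0 addr0. Qed.

Lemma next_cyc_comp j x : cell_bd x = 0 -> cell_bd (compF (@cdeg s) j x) = 0.
Proof.
move=> x0; have := comp_map (gradingF (@cdeg s)) (e := 0) (phi := cell_bd)
  (gradingF (@sdeg s)) _ j x.
rewrite /= x0 addr0 => <-; first exact: (comp0 (gradingF _)).
by move=> i y; rewrite addr0; exact: cell_bd_homog.
Qed.

Lemma next_cyc_lift z : cell_bd z = 0 ->
  exists2 w, pos w & dT w = lext sigma (@cval s) z.
Proof.
move=> z0; apply: exactT; first by apply: pos_lext => c; exact: cval_pos.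
by rewrite -val_cell_bd z0 raddf0.
Qed.

Lemma next_zeta_homog k c : homogF (@cdeg s) (cdeg c + 2%:Z) (next_zeta k c).
Proof.
apply: homogFD.
  apply: homogFZ => //; rewrite -[cdeg c]addr0; apply: homogFU.
  exact: homogA1.
by apply: homogFN; apply: raise_homog; exact: cbd_homog.
Qed.

Lemma next_zeta_cyc k c : cell_bd (next_zeta k c) = 0.
Proof.
rewrite linearB linearZ /= cell_bd_raise zeta_on_cyc; last exact: cbd_cyc.
by rewrite /cell_bd lmapU scale1r subrr.
Qed.

(** This is where the homotopy relation in [T] is used:
    [a w - e_k (d w) = d (e_k w)]. *)
Lemma next_zeta_val k c :
  lext sigma (@cval s) (next_zeta k c) = dT (E k (cval c)).
Proof.
rewrite raddfB /= lextZ lextU rmorph1 scale1r val_raise -d_cval.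
by rewrite -homotopy addrK.
Qed.

Lemma next_zeta_on_cyc k z : cell_bd z = 0 -> lmap (next_zeta k) z = f k *: z.
Proof. by move=> z0; rewrite lmap_next_zeta z0 linear0 subr0. Qed.

Definition next : stage :=
  @Stage (cell s) (@cdeg s) [set x | cell_bd x = 0] (@cval s) next_zeta
    (linear0 cell_bd) next_cyc_linear next_cyc_comp next_cyc_lift
    next_zeta_homog next_zeta_cyc next_zeta_val next_zeta_on_cyc.

End Next.

(** The resolution is started one step early, from [A] as a free module on one
    generator: its cycles are the elements of [I], as in a resolution of
    [A / I]. *)
Definition base_zeta k (_ : unit) : freeA R n unit := << f k *g tt >>.

Lemma free_unit (x : freeA R n unit) : x = << x@_tt *g tt >>.
Proof. by apply/malgP => -[]; rewrite mcoeffUU. Qed.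

Lemma base_lift z : I z@_tt ->
  exists2 w, pos w & dT w = lext sigma (fun=> one) z.
Proof. by rewrite [in lext _ _ _](free_unit z) lextU; exact: liftI. Qed.

Lemma base_cyc0 : I (mcoeff tt (0 : freeA R n unit)).
Proof. by rewrite mcoeff0; exact: I_ideal.1. Qed.

Lemma base_cyc_linear c (x y : freeA R n unit) :
  I x@_tt -> I y@_tt -> I (c *: x + y)@_tt.
Proof. by move=> Ix Iy; rewrite mcoeffD mcoeffZ; apply: I_ideal.2. Qed.

Lemma base_cyc_comp j (x : freeA R n unit) :
  I x@_tt -> I (compF (fun=> 0) j x)@_tt.
Proof. by move=> Ix; rewrite mcoeff_compF; exact: I_graded. Qed.

Lemma base_zeta_homog k b : homogF (fun=> 0) (0 + 2%:Z) (base_zeta k b).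
Proof. by case: b; apply: homogFU. Qed.

Lemma base_zeta_cyc k b : I (base_zeta k b)@_tt.
Proof. by rewrite mcoeffUU. Qed.

Lemma base_zeta_val k b :
  lext sigma (fun=> one) (base_zeta k b) = dT (E k one).
Proof. by rewrite lextU -homotopy d_one linear0 addr0. Qed.

Lemma base_zeta_on_cyc k (z : freeA R n unit) :
  lmap (base_zeta k) z = f k *: z.
Proof.
rewrite [in RHS](free_unit z) [in LHS](free_unit z) lmapU /base_zeta.
apply/malgP => -[]; rewrite [LHS]mcoeffZ [RHS]mcoeffZ 2!mcoeffUU.
exact: mulrC.
Qed.

Definition base : stage :=
  @Stage unit (fun=> 0) [set x | I x@_tt] (fun=> one) base_zeta
    base_cyc0 base_cyc_linear base_cyc_comp base_lift base_zeta_homog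
    base_zeta_cyc base_zeta_val (fun k z _ => base_zeta_on_cyc k z).

(** [tower i] is the module in homological degree [i] over [A / I], hence in
    degree [i - 1] over [I]. *)
Definition tower (i : nat) : stage := iter i next base.

Definition aug : freeA R n (bas (tower 1)) -> A^o :=
  lmap (fun c : cell base => mcoeff tt (cbd c) : A^o).
HB.instance Definition _ := GRing.Linear.on aug.

Lemma augE x : aug x = mcoeff tt (cell_bd (s := base) x).
Proof. by rewrite /cell_bd mcoeff_lmap. Qed.

Lemma aug_homog j x : homogF (@sdeg (tower 1)) j x -> homogA j (aug x).
Proof.
by move=> /cell_bd_homog /(_ tt); rewrite augE /= subr0.
Qed.

Lemma aug_range : range aug = I.
Proof.
apply/seteqP; split=> [_ [x _ <-]|p Ip].
  rewrite augE; exact: (@cyc_cell_bd base x).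
have : cyc (s := base) << p *g tt >> by rewrite /= mcoeffUU.
rewrite -range_cell_bd => -[x _ hx].
by exists x => //; rewrite augE hx mcoeffUU.
Qed.

Lemma aug_exact : range (cell_bd (s := tower 1)) = [set x | aug x = 0].
Proof.
rewrite range_cell_bd; apply/seteqP; split=> x /=; rewrite augE.
  by move=> ->; rewrite mcoeff0.
by move=> x0; rewrite [cell_bd x]free_unit x0 monalgU0.
Qed.

Lemma tower_exact i :
  range (cell_bd (s := tower i.+2)) = [set x | cell_bd (s := tower i.+1) x = 0].
Proof. exact: range_cell_bd. Qed.

Definition tower_resolution : free_resolution I :=
  @Build_free_resolution R n I (fun i => bas (tower i.+1))
    (fun i => @sdeg (tower i.+1)) (fun i => @cell_bd (tower i.+1)) aug
    (fun i j x => @cell_bd_homog (tower i.+1) j x) aug_homog aug_range aug_exact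
    tower_exact.

Section Top.
Variable k : nat -> X.

(** The product of the classes of [f (k 0), ..., f (k (i - 1))], formed by
    applying the homotopies to the generator of [A]. *)
Fixpoint ytop i : freeA R n (bas (tower i)) :=
  match i with
  | 0 => << tt >>
  | i'.+1 => lmap (@raise (tower i') (k i')) (ytop i')
  end.

Fixpoint wtop i : T := if i is i'.+1 then E (k i') (wtop i') else one.

Lemma ytop_homog i : homogF (@sdeg (tower i)) (2 * i)%:Z (ytop i).
Proof.
elim: i => [|i IH].
  by have := @homogFU R n unit (fun=> 0) 0 1 tt (@homogA1 R n); rewrite addr0.
by rewrite mulnS addnC PoszD; apply: raise_homog.
Qed.

Lemma ytop_val i : lext sigma (@wval (tower i)) (ytop i) = wtop i.
Proof.
elim: i => [|i IH] /=; first by rewrite lextU rmorph1 scale1r.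
by rewrite val_raise IH.
Qed.

(** By induction on [i]: [zeta] at [h y] is [f h y - h (d h y)], and
    [d h y = zeta y].  As the differential of [ytop i.+1] is [zeta] at
    [ytop i], this also says that [ytop] is a cycle modulo the irrelevant
    ideal. *)
Lemma ytop_zeta i k' : irrelevantF (lmap (@zeta (tower i) k') (ytop i)).
Proof.
elim: i k' => [|i IH] k' b.
  rewrite lmapU scale1r mcoeffU; case: eqP => _; first exact: f_irr.
  exact: (irrelevant_ideal R n).1.
rewrite lmap_next_zeta mcoeffB cell_bd_raise mcoeffZ -mulN1r addrC.
apply: (irrelevant_ideal R n).2; first exact: (irrelevantF_lmap _ (IH (k i))).
exact: (idealMr _ (irrelevant_ideal R n) (f_irr k')).
Qed.

(** [tau] stands for the top coefficient of [T]. *)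
Variable tau : {linear T -> A^o}.
Hypothesis tau_d : forall t, tau (dT t) = 0.
Hypothesis sigma_irr : forall p, irrelevant p -> (sigma p)@_mone = 0.

Lemma tau_irr (K : choiceType) (v : K -> T) x : irrelevantF x ->
  (tau (lext sigma v x) : A)@_mone = 0.
Proof.
move=> hx; rewrite linear_lext /lext raddf_sum big1// => b _.
have := rmorphM (mcoeff (mone : {cmonom _})) (sigma x@_b) (tau (v b) : A).
by rewrite /= (sigma_irr (hx b)) mul0r.
Qed.

(** If [ytop] were a boundary modulo the irrelevant ideal, its value in [T]
    would be a boundary of [T], which [tau] kills, plus a combination whose
    coefficients vanish at the origin. *)
Theorem tower_tor m : (tau (wtop m.+1) : A)@_mone != 0 ->
  tor_neq0 I m (2 * m.+1)%:Z.
Proof.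
move=> tau_top; exists tower_resolution, (ytop m.+1); split.
- exact: ytop_homog.
- case: m {tau_top} => [//|m]; rewrite /tor_cycle /=.
  by rewrite cell_bd_raise; exact: (@ytop_zeta m.+1 (k m.+1)).
case=> u hu; move: tau_top; rewrite -ytop_val.
rewrite -[ytop _](subrK (cell_bd (s := tower m.+1) u)).
rewrite raddfD [X in tau (_ + X)](@val_cell_bd (tower m.+1) u).
rewrite linearD tau_d addr0 => /eqP; apply.
exact: tau_irr.
Qed.
End Top.
End Tower.

(** * Substitutions and the action of the general linear group *)

Section Substitution.
Variables (V : choiceType) (C : comNzRingType) (S : comNzRingType).
Variable h : V -> S.

Definition mon_eval (m : {cmonom V}) : S := \prod_(v <- finsupp m) h v ^+ m v.

Lemma mon_evalEw (d : {fset V}) (m : {cmonom V}) : (finsupp m `<=` d)%fset ->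
  mon_eval m = \prod_(v <- d) h v ^+ m v.
Proof.
move=> le; rewrite /mon_eval (big_fset_incl _ le) // => v _.
by rewrite -cmE_eq0 => /eqP ->; rewrite expr0.
Qed.

Lemma mon_eval_mmorphism : mmorphism mon_eval.
Proof.
split=> [m1 m2|]; last by rewrite /mon_eval mdom1 big_seq_fset0.
rewrite {1}/mon_eval mdomD (mon_evalEw (fsubsetUl _ (finsupp m2))).
rewrite (mon_evalEw (fsubsetUr (finsupp m1) _)) -big_split.
by apply: eq_bigr => v _; rewrite cmM exprD.
Qed.

HB.instance Definition _ :=
  isMultiplicative.Build {cmonom V} S mon_eval mon_eval_mmorphism.

Lemma mon_evalU v : mon_eval (ucm v) = h v.
Proof. by rewrite /mon_eval mdomU big_seq_fset1 cmUU expr1. Qed.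
End Substitution.

Section Specific.
Variables (R : realType) (n : nat).
Notation C := (R[i]).
Notation A := (polyA R n).
Notation var := ('I_n * nat)%type.
Implicit Types (p q : A).

Definition subst (h : var -> A) : A -> A :=
  mmap (@mkmalgU _ C mone) (mon_eval h).
HB.instance Definition _ h := GRing.RMorphism.on (subst h).

Lemma subst_var h v : subst h (varA R v) = h v.
Proof. by rewrite /subst mmapU mon_evalU /= mpolyC1E mul1r. Qed.

Lemma gl_actE k (g : 'M[C]_k) p : gl_act g p = subst (gl_var g) p.
Proof. by []. Qed.

(** [malg_ind] stated with the ring operations of [A], so that later goals stay
    syntactically in the ring. *)
Lemma polyA_ind (P : A -> Prop) : P 0 ->
  (forall p q, P p -> P q -> P (p + q)) ->
  (forall (c : C) (m : {cmonom var}), P << c *g m >>) -> forall p, P p.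
Proof. exact: malg_ind. Qed.

Lemma homogA_var v : homogA 1 (varA R v : A).
Proof. by have := @homogAU R n 1 (ucm v); rewrite mdegU. Qed.

Lemma homogA_prod (T : Type) (s : seq T) (F : T -> A) (e : T -> nat) :
  (forall t, homogA (e t)%:Z (F t)) ->
  homogA (\sum_(t <- s) e t)%N%:Z (\prod_(t <- s) F t).
Proof.
move=> hF; elim: s => [|t s IH]; first by rewrite !big_nil; exact: homogA1.
by rewrite !big_cons PoszD; apply: homogAM.
Qed.

Lemma homogAX e p : homogA 1 p -> homogA e%:Z (p ^+ e).
Proof.
move=> hp; elim: e => [|e IH]; first exact: homogA1.
by rewrite exprS -addn1 addnC PoszD; apply: homogAM.
Qed.

Lemma homogAC (c : C) : homogA 0 (malgC c : A).
Proof. by have := @homogAU R n c mone; rewrite mdeg1. Qed.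

Lemma homogA_subst h j p : (forall v, homogA 1 (h v)) ->
  homogA j p -> homogA j (subst h p).
Proof.
move=> hh hp; rewrite /subst /mmap big_seq; apply: homogA_sum => m mp.
rewrite -(hp _ mp) -[(mdeg m)%:Z]add0r; apply: homogAM; first exact: homogAC.
by apply: homogA_prod => v; exact: homogAX.
Qed.

(** The group acts on columns only: the coefficients [s] are the same for every
    row [i]. *)
Lemma gl_var_comb k (g : 'M[C]_k) c : exists s : seq (C * nat),
  forall i, gl_var g (i, c) = \sum_(t <- s) malgC t.1 * @varA R n (i, t.2).
Proof.
rewrite /gl_var /=; case: insubP => [j _ _|_].
  exists [seq (g l j, val l) | l <- enum 'I_k] => i.
  by rewrite big_map big_enum.
by exists [:: (1, c)] => i; rewrite big_seq1 mpolyC1E mul1r.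
Qed.

Lemma gl_var_homog k (g : 'M[C]_k) (v : var) : homogA 1 (gl_var g v).
Proof.
case: v => i c; have [s ->] := gl_var_comb g c.
apply: homogA_sum => t _.
by have := homogAM (@homogAC t.1) (@homogA_var (i, t.2)); rewrite add0r.
Qed.

(** * Division by the square of a variable *)

(** The quotient in the division by [x_v^2] with remainder of degree at most 1
    in [x_v]. *)
Definition div_sq (v : var) : A -> A :=
  lmap (fun m : {cmonom var} =>
    if (2 <= m v)%N then << divcm m (mulcm (ucm v) (ucm v)) >> else 0 : A).
HB.instance Definition _ v := GRing.Linear.on (div_sq v).

Lemma div_sq0 v : div_sq v 0 = 0.
Proof. exact: (raddf0 (div_sq v)). Qed.

Lemma div_sqD v p q : div_sq v (p + q) = div_sq v p + div_sq v q.
Proof. exact: (raddfD (div_sq v)). Qed.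

Lemma div_sqU v (c : C) (m : {cmonom var}) : div_sq v << c *g m >> =
  if (2 <= m v)%N then << c *g divcm m (mulcm (ucm v) (ucm v)) >> else 0.
Proof.
transitivity (c *: (if (2 <= m v)%N then
    << divcm m (mulcm (ucm v) (ucm v)) >> else 0 : A)); first exact: lmapU.
by case: (2 <= m v)%N; [exact: scale_malgU|exact: scaler0].
Qed.

Lemma var_sqM v c (m : {cmonom var}) :
  varA R v ^+ 2 * << c *g m >> =
  << c *g mulcm (mulcm (ucm v) (ucm v)) m >> :> A.
Proof.
have mulU (m1 m2 : {cmonom var}) (c1 c2 : C) :
    << c1 *g m1 >> * << c2 *g m2 >> = << c1 * c2 *g mulcm m1 m2 >> :> A.
  exact: fgmulUU.
by rewrite expr2 /varA !mulU !mul1r.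
Qed.

Lemma div_sqK v p : div_sq v (varA R v ^+ 2 * p) = p.
Proof.
elim/polyA_ind: p => [|p q IHp IHq|c m]; first by rewrite mulr0 div_sq0.
  by rewrite mulrDr div_sqD; exact: (congr2 +%R IHp IHq).
rewrite var_sqM div_sqU !mulcmE !ucmE eqxx /=.
have -> // :
  divcm (mulcm (mulcm (ucm v) (ucm v)) m) (mulcm (ucm v) (ucm v)) = m.

by apply/eqP/cmP => i; rewrite divcmE !mulcmE addKn.
Qed.

Lemma div_sqM v w p : w != v ->
  div_sq v (varA R w ^+ 2 * p) = varA R w ^+ 2 * div_sq v p.
Proof.
move=> wv; elim/polyA_ind: p => [|p q IHp IHq|c m].
- by rewrite mulr0 !div_sq0 mulr0.
- rewrite mulrDr !div_sqD [RHS]mulrDr; exact: (congr2 +%R IHp IHq).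
rewrite var_sqM [LHS]div_sqU [div_sq v << c *g m >>]div_sqU.
have -> : mulcm (mulcm (ucm w) (ucm w)) m v = m v.
  by rewrite !mulcmE !ucmE (negPf wv).
case m2: (2 <= m v)%N; last by rewrite mulr0.
rewrite var_sqM.
set m1 := divcm _ _; set m2' := mulcm _ (divcm _ _).
have -> // : m1 = m2'.
apply/eqP/cmP => i; rewrite !(divcmE, mulcmE, ucmE).
have [<-|vi] := eqVneq v i; last by rewrite !addn0 !subn0.
by rewrite (negPf wv) !add0n.
Qed.

(** * The ideal generated by the Gram polynomials *)

Definition gram (a b : nat) : A := \sum_(i < n) varA R (i, a) * varA R (i, b).

Lemma gram_homog a b : homogA 2%:Z (gram a b).
Proof.
apply: homogA_sum => i _.
exact: (homogAM (@homogA_var (i, a)) (@homogA_var (i, b))).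
Qed.

Lemma irrelevant_var v : irrelevant (varA R v : A).
Proof. by apply: sub_gen_smallest; exists v. Qed.

Lemma gram_irrelevant a b : irrelevant (gram a b).
Proof.
apply: ideal_sum => [|i _]; first exact: irrelevant_ideal.
exact: (idealMl _ (irrelevant_ideal R n) (irrelevant_var _)).
Qed.

Definition gram_ideal : set A :=
  smallest (@ideal R n) [set p | exists a b, p = gram a b].

(** The Gram polynomials are the entries of [X^T X], and [g] maps this matrix to
    [g^T X^T X g]. *)
Lemma gl_act_gram k (g : 'M[C]_k) a b : gram_ideal (gl_act g (gram a b)).
Proof.
have [s hs] := gl_var_comb g a; have [t ht] := gl_var_comb g b.
have -> : gl_act g (gram a b) =
    \sum_(x <- s) \sum_(y <- t) (malgC x.1 * malgC y.1) * gram x.2 y.2.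
  rewrite gl_actE rmorph_sum /=.
  transitivity (\sum_(i < n) \sum_(x <- s) \sum_(y <- t)
      (malgC x.1 * malgC y.1) * (varA R (i, x.2) * varA R (i, y.2)) : A).
    apply: eq_bigr => i _.
    rewrite rmorphM [X in X * _]subst_var [X in _ * X]subst_var.
    rewrite [X in X * _]hs [X in _ * X]ht big_distrlr.
    by apply: eq_bigr => x _; apply: eq_bigr => y _; exact: mulrACA.
  rewrite exchange_big; apply: eq_bigr => x _ /=.
  by rewrite exchange_big; apply: eq_bigr => y _ /=; rewrite mulr_sumr.
have gi : ideal gram_ideal by exact: smallest_ideal.
apply: ideal_sum => // x _; apply: ideal_sum => // y _; apply: (idealMl _ gi).
by apply: sub_gen_smallest; exists x.2, y.2.
Qed.

Lemma gram_GL_ideal : GL_ideal gram_ideal.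
Proof.
split=> [|k g _ p Ip]; first exact: smallest_ideal.
have Jid :=
  @ideal_preimage R n (subst (gl_var g)) gram_ideal (smallest_ideal _).
apply: (smallest_sub Jid _ Ip) => _ [a [b ->]]; exact: gl_act_gram.
Qed.

Section GLIdeal.
Variable S : set A.
Let I : set A := smallest (@GL_ideal R n) S.

Lemma smallest_GL_ideal : GL_ideal I.
Proof.
split; first split.
- by move=> J [[[]]].
- by move=> a p q Ip Iq J SJ; have [[[_ Jl] _] _] := SJ; apply: Jl;
    [apply: Ip; exact: SJ|apply: Iq; exact: SJ].
- move=> k g gu p Ip J SJ; have [[_ Jg] _] := SJ.
  by apply: Jg => //; apply: Ip; exact: SJ.
Qed.

Let grA := @gradingA R n.

(** The elements all of whose components lie in [I] form a GL-ideal, because the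
    group preserves degrees; it contains the generators. *)
Lemma smallest_GL_graded : (forall p, S p -> exists e, homogA e p) ->
  forall j p, I p -> I (compA j p).
Proof.
move=> hS j p Ip; have [Ii Ig] := smallest_GL_ideal.
suff : [set p | forall j, I (compA j p)] p by apply.
apply: (smallest_sub _ _ Ip); last first.
  move=> q Sq j'; have [e he] := hS _ Sq.
  have [<-|ej] := eqVneq e j'.
    by rewrite (comp_id grA he); apply: sub_gen_smallest.
  by rewrite (comp_ne grA he)//; exact: Ii.1.
split; first split.
- by move=> j'; rewrite (comp0 grA); exact: Ii.1.
- move=> a q r Iq Ir j'; rewrite (compD grA).
  apply: (idealD Ii) => //.
  elim/(homog_ind grA): a => [|a b Ia Ib|e a ha].
  + by rewrite mul0r (comp0 grA); exact: Ii.1.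
  + by rewrite mulrDl (compD grA); apply: (idealD Ii).
  have := @comp_map _ _ _ grA _ _ _ (a \*o idfun) e grA _ (j' - e) q.
  rewrite subrK /= => ->; first by apply: (idealMl _ Ii).
  by move=> i x hx; rewrite addrC; apply: homogAM.
move=> k g gu q Iq j'; rewrite gl_actE.
have := @comp_map _ _ _ grA _ _ _ (subst (gl_var g)) 0 grA _ j' q.
rewrite addr0 => ->; first exact: Ig.
by move=> i x hx; rewrite addr0; apply: homogA_subst => //; exact: gl_var_homog.
Qed.
End GLIdeal.

(** Exchanging the columns 0 and [k]; [i0] is the index 0, which exists once
    there is [k : 'I_n]. *)
Lemma gl_act_gram00 (i0 k : 'I_n) : val i0 = 0%N ->
  gl_act (tperm_mx i0 k : 'M[C]_n) (gram 0 0) = gram k k.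
Proof.
move=> i00; rewrite gl_actE rmorph_sum /=; apply: eq_bigr => i _.
rewrite rmorphM /= subst_var.
suff -> : gl_var (tperm_mx i0 k : 'M[C]_n) (i, 0%N) = varA R (i, val k) by [].
rewrite /gl_var /= -i00 valK (bigD1 k)//= big1 => [|l lk].
  by rewrite !mxE perm.tpermR eqxx mpolyC1E mul1r addr0.
rewrite !mxE -{2}(perm.tpermR i0 k) (inj_eq perm.perm_inj) (negPf lk).
by rewrite raddf0 mul0r.
Qed.

(** * Specialization to the diagonal *)

Definition diag_spec : A -> A :=
  subst (fun v => if v.2 == val v.1 then varA R v else 0).
HB.instance Definition _ := GRing.RMorphism.on diag_spec.

Lemma diag_spec_var v :
  diag_spec (varA R v) = if v.2 == val v.1 then varA R v else 0.
Proof. exact: subst_var. Qed.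

Lemma diag_gram a b :
  diag_spec (gram a b) =
  \sum_(i < n | (a == val i) && (b == val i)) varA R (i, val i) ^+ 2.
Proof.
rewrite rmorph_sum /= [RHS]big_mkcond /=; apply: eq_bigr => i _.
rewrite rmorphM [X in X * _]diag_spec_var [X in _ * X]diag_spec_var /=.
case: eqP => [->|_]; last by rewrite mul0r.
by case: eqP => [->|_]; rewrite ?mulr0 ?expr2.
Qed.

Lemma diag_gram_ne a b : a != b -> diag_spec (gram a b) = 0.
Proof.
move=> ab; rewrite diag_gram big1// => i /andP[/eqP ai /eqP bi].
by rewrite ai bi eqxx in ab.
Qed.

Lemma diag_gram_diag (k : 'I_n) : diag_spec (gram k k) = varA R (k, val k) ^+ 2.
Proof.
rewrite diag_gram (bigD1 k) ?eqxx//= big1 ?addr0// => i.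
move=> /andP[/andP[/eqP ki _] /eqP].
by case; apply: val_inj.
Qed.

Lemma diag_gram_ge a b : (n <= a)%N -> diag_spec (gram a b) = 0.
Proof.
move=> na; rewrite diag_gram big1// => i /andP[/eqP ai _].
by have := ltn_ord i; rewrite -[nat_of_ord i]ai ltnNge na.
Qed.

Lemma const0_ideal : ideal [set p : A | p@_mone = 0].
Proof.
split=> [|a p q p0 q0]; first exact: mcoeff0.
have aE := rmorphM (mcoeff (mone : {cmonom var})) a p.
by rewrite /= mcoeffD q0 addr0 aE /= p0 mulr0.
Qed.

Lemma diag_spec_irrelevant p : irrelevant p -> (diag_spec p)@_mone = 0.
Proof.
have Jid := @ideal_preimage R n diag_spec _ const0_ideal.
apply: (smallest_sub Jid) => _ [v _ <-].
rewrite /= diag_spec_var; case: ifP => _; last exact: mcoeff0.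
by rewrite mcoeffU cm1_eq1.
Qed.
End Specific.

(** * Nonvanishing of Tor for the sum of squares *)

Section Final.
Variables (R : realType) (n' : nat).
Local Notation n := n'.+1.
Notation A := (polyA R n).

(** Indexed by all of [nat], as [koszul] requires; the row [inord k] is [k] for
    [k < n], and keeping [k] as the column makes these variables distinct for
    all [k]. *)
Definition diag_idx (k : nat) : 'I_n * nat := (inord k, k).
Definition diag_sq (k : nat) : A := varA R (diag_idx k) ^+ 2.

Lemma diag_gram_sq (k : 'I_n) : diag_spec (gram R n k k) = diag_sq k.
Proof. by rewrite diag_gram_diag /diag_sq /diag_idx inord_val. Qed.

Definition sos_ideal : set A :=
  smallest (@GL_ideal R n) (range (fun _ : 'I_1 => gram R n 0 0)).

Lemma sos_gram (k : 'I_n) : sos_ideal (gram R n k k).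
Proof.
rewrite -(@gl_act_gram00 R n ord0)//.
apply: (smallest_GL_ideal _).2; first exact: unitmx_perm.
by apply: sub_gen_smallest; exists ord0.
Qed.

Lemma lift_ideal k : ideal [set p : A | exists2 w : koszul A k,
  koszul_pos w & koszul_d diag_sq w = diag_spec p *: koszul_one A k].
Proof.
split=> [|a q r [u upos du] [v vpos dv]].
  by exists 0; [exact: koszul_pos0|rewrite linear0 rmorph0 scale0r].
exists (diag_spec a *: u + v); first exact: koszul_pos_linear.
apply: (etrans (linearP (koszul_d diag_sq (k := k)) (diag_spec a) u v)).
apply: (etrans (congr2 (fun x y => diag_spec a *: x + y) du dv)).
have E : diag_spec (a * q + r) = diag_spec a * diag_spec q + diag_spec r.
  by rewrite [LHS]rmorphD [X in X + _]rmorphM.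
by rewrite E [RHS]scalerDl -[X in _ = X + _]scalerA.
Qed.

(** The number [k] of elements is kept as a variable equal to [n = n'.+1], since
    otherwise simplification would unfold the first cone. *)
Lemma lift_gram k a b : k = n -> exists2 w : koszul A k,
  koszul_pos w &
  koszul_d diag_sq w = diag_spec (gram R n a b) *: koszul_one A k.
Proof.
move=> kn.
have zero : diag_spec (gram R n a b) = 0 -> exists2 w : koszul A k,
    koszul_pos w &
    koszul_d diag_sq w = diag_spec (gram R n a b) *: koszul_one A k.
  by move=> ->; exists 0; [exact: koszul_pos0|rewrite linear0 scale0r].
have [ab|ab] := eqVneq a b; last by apply: zero; exact: diag_gram_ne.
have [na|an] := leqP n a; first by apply: zero; exact: diag_gram_ge.
rewrite -ab (diag_gram_sq (Ordinal an)).
exists (koszul_e a (koszul_one A k)); first exact: koszul_pos_e.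
have := koszul_homotopy diag_sq (koszul_one A k); rewrite kn => /(_ _ an).
by rewrite koszul_d_one linear0 addr0.
Qed.

Lemma sos_lift p : sos_ideal p ->
  exists2 w : koszul A n,
  koszul_pos w & koszul_d diag_sq w = diag_spec p *: koszul_one A n.
Proof.
move=> Ip.
have {}Ip : @gram_ideal R n p.
  apply: (smallest_sub (@gram_GL_ideal R n) _ Ip) => _ [_ _ <-].
  by apply: sub_gen_smallest; exists 0%N, 0%N.
apply: (smallest_sub (lift_ideal n) _ Ip) => _ [a [b ->]].
exact: lift_gram.
Qed.

Definition koszul_e_lin k (i : 'I_n) : {linear koszul A k -> koszul A k} :=
  @koszul_e A i k.

Lemma wtop_koszul k i : (i <= n)%N ->
  wtop (koszul_one A k) (@koszul_e_lin k) (fun j => inord j) i =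
  koszul_chain A k i.
Proof. by elim: i => [|i IH] // lin; rewrite /= inordK// IH ?(ltnW lin). Qed.

Lemma sos_graded j p : sos_ideal p -> sos_ideal (compA j p).
Proof.
apply: smallest_GL_graded => _ [_ _ <-]; exists 2%:Z; exact: gram_homog.
Qed.

Definition diag_sq_div k : A -> A := div_sq (diag_idx k).
HB.instance Definition _ k := GRing.Linear.on (diag_sq_div k).

Lemma diag_sq_exact k (t : koszul A k) :
  koszul_pos t -> koszul_d diag_sq t = 0 ->
  exists2 s, koszul_pos s & koszul_d diag_sq s = t.
Proof.
apply: (@koszul_exact A diag_sq (fun i => diag_sq_div i)) => [i p|i j p ij].
  exact: div_sqK.
by apply: div_sqM; apply: contra ij => /eqP[_ ->].
Qed.

Lemma diag_sq_homotopy k (i : 'I_n) (t : koszul A k) : k = n ->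
  koszul_d diag_sq (koszul_e_lin k i t) + koszul_e_lin k i (koszul_d diag_sq t)
  = diag_spec (gram R n i i) *: t.
Proof.
by move=> kn; rewrite diag_gram_sq; apply: koszul_homotopy; rewrite kn.
Qed.

Lemma sos_tor : tor_neq0 sos_ideal n' (2 * n)%:Z.
Proof.
have [Ii _] := smallest_GL_ideal (range (fun _ : 'I_1 => gram R n 0 0)).
refine (@tower_tor R n sos_ideal (diag_spec (R:=R) (n:=n)) (koszul A n)
  (@koszul_d A diag_sq n) (@koszul_pos A n) (koszul_one A n)
  'I_n (fun k => gram R n k k) (@koszul_e_lin n)
  Ii sos_graded sos_gram
  (fun k => @gram_homog R n k k) (fun k => @gram_irrelevant R n k k)
  (koszul_pos0 A n) (@koszul_pos_linear A n) (fun k t => koszul_pos_e k t)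
  (@diag_sq_exact n) (fun k t => diag_sq_homotopy k t erefl)
  (koszul_d_one diag_sq n) sos_lift
  (fun j => inord j) (@koszul_top A n) (@koszul_top_d A diag_sq n)
  (@diag_spec_irrelevant R n) n' _).
rewrite wtop_koszul// [X in mcoeff _ X](koszul_top_chain A n).
by rewrite mcoeff1 eqxx oner_neq0.
Qed.
End Final.

Theorem corollary1p3 (R : realType) :
  ~ exists N : nat -> nat -> nat,
      (forall d r, (0 < d)%N -> (0 < r)%N -> (0 < N d r)%N) /\
      forall d r n : nat, (0 < d)%N -> (0 < r)%N -> (0 < n)%N ->
      forall (f : 'I_r -> polyA R n) (I : set (polyA R n)),
        (forall k, exists2 e, (e <= d)%N & homogA e%:Z (f k)) ->
        I = smallest (@GL_ideal R n) (range f) ->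
        (regularity I < (N d r)%:R%:E)%E.
Proof.
(* The regularity is at least [n + 1 = N 2 1 + 2] when [n = N 2 1 + 1]. *)
move=> [N [_ hN]]; set n' := N 2 1.
have := hN 2 1%N n'.+1 isT isT isT (fun=> gram R n'.+1 0 0) (@sos_ideal R n')
  (fun _ => ex_intro2 _ _ 2 isT (@gram_homog R _ 0 0)) erefl.
apply/negP; rewrite -leNgt.
apply: le_trans (ereal_sup_ubound _); last first.
  by exists (n', (2 * n'.+1)%:Z) => //; exact: sos_tor.
rewrite lee_fin /= -[X in X <= _]mulrz_nat ler_int -/n'.
lia.
Qed.
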